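(* Let $X$ be a Tychonoff space. If $P_\tau(X)$ is pseudocompact, then $X$ is pseudocompact.
   Context: $\beta X$ is the Stone–Čech compactification of $X$. $P(\beta X)$ is the set of Radon probability measures on the Borel $\sigma$-algebra of $\beta X$, with the weak topology, i.e. the topology generated by the functions $\mu\mapsto\int f\,d\mu$ for continuous $f:\beta X\to\mathbb R$. $P_\tau(X)$ is the subspace of all $\mu\in P(\beta X)$ such that $\mu(K)=0$ for every compact set $K\subset\beta X\setminus X$. A space is pseudocompact if every continuous real-valued function on it is bounded. *)

(* Defs.v *)
From HB Require Import structures.
From mathcomp Require Import all_boot all_order all_algebra.
From mathcomp Require Import all_classical all_reals all_analysis.

Set Implicit Arguments.
Unset Strict Implicit.
Unset Printing Implicit Defensive.

Import Order.TTheory GRing.Theory Num.Theory.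
Import numFieldNormedType.Exports.

Local Open Scope classical_set_scope.
Local Open Scope ring_scope.

Definition tychonoff_space (X : topologicalType) : Prop :=
  hausdorff_space X /\ completely_regular_space X.

Definition pseudocompact (R : realType) (X : topologicalType) : Prop :=
  forall f : X -> R, continuous f -> bounded_fun f.

Section stone_cech.
Variables (R : realType) (X : topologicalType).

Definition unit_function : Type :=
  {f : X -> R | continuous f /\ range f `<=` `[0, 1]}.

Definition unit_evaluation (x : X) : prod_topology (fun _ : unit_function => R) :=
  fun f => sval f x.

(* The image of X lies in the cube [0,1]^I inside R^I, where I is the set of
   continuous functions from X to [0,1]. The cube is closed in R^I, so this
   closure is the closure in the cube. *)
Definition stone_cech : topologicalType :=
  set_type (closure (range unit_evaluation)).

Definition stone_cech_embedding (x : X) : stone_cech :=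
  exist _ (unit_evaluation x)
    (mem_set (@subset_closure _ (range unit_evaluation) (unit_evaluation x)
       (imageT unit_evaluation x))).

End stone_cech.

(* Measurable types are pointed. A space that carries a probability measure is
   nonempty, so the base point is extracted from a proof of inhabitance: this
   leaves the empty space in scope, and no choice of base point is recorded. *)
Section borel.
Variables (B : topologicalType) (B0 : inhabited B).

Definition pointed_space of inhabited B : Type := B.

HB.instance Definition _ := Topological.copy (pointed_space B0) B.
HB.instance Definition _ :=
  isPointed.Build (pointed_space B0) (inhabited_witness B0).

Definition borel_space : measurableType (@open (pointed_space B0)).-sigma :=
  g_sigma_algebraType (@open (pointed_space B0)).

End borel.

(* A measure of the library is a function on all subsets, constrained only on
   the measurable ones. Requiring the value 0 elsewhere makes equality in this
   type coincide with equality on Borel sets. *)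
Record radon_probability (R : realType) (B : topologicalType) : Type :=
  RadonProbability {
    radon_inhabited : inhabited B ;
    radon_measure :> probability (borel_space radon_inhabited) R ;
    radon_inner_regular : forall A : set B, <<s @open B >> A ->
      radon_measure A =
        ereal_sup [set radon_measure K | K in [set K : set B | compact K /\ K `<=` A]] ;
    radon_off_borel : forall A : set B, ~ <<s @open B >> A ->
      radon_measure A = 0%E }.

Section weak_topology.
Variables (R : realType) (B : topologicalType).

HB.instance Definition _ := gen_eqMixin (radon_probability R B).
HB.instance Definition _ := gen_choiceMixin (radon_probability R B).

Definition radon_integral (f : B -> R) (mu : radon_probability R B) : R :=
  \int[radon_measure mu]_x f x.

HB.instance Definition _ := Topological.copy (radon_probability R B)
  (sup_topology (fun f : {f : B -> R | continuous f} =>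
     Topological.class (initial_topology (radon_integral (sval f))))).

End weak_topology.

Definition P_tau (R : realType) (X : topologicalType) : topologicalType :=
  set_type [set mu : radon_probability R (stone_cech R X) |
    forall K : set (stone_cech R X),
      compact K -> K `&` range (@stone_cech_embedding R X) = set0 ->
      radon_measure mu K = 0%E].

(* Main.v *)
(* Given a continuous [f : X -> R], the function [1 / (1 + |f|)] takes values in
   [0, 1], hence extends to a continuous [h] on the compactification, with no
   zero on [X]. The zero set of [h] is compact and misses [X], so every [mu] in
   [P_tau X] gives it measure 0 and the integral of [h] against [mu] is positive.
   Thus [mu |-> 1 / (integral of h)] is continuous on [P_tau X], and its value
   at the Dirac mass of [x] is [1 + |f x|]: if it is bounded, so is [f]. *)
Require Import Defs.
From HB Require Import structures.
From mathcomp Require Import all_boot all_order all_algebra.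
From mathcomp Require Import all_classical all_reals all_analysis.
From mathcomp Require Import measurable_realfun.
Set Implicit Arguments.
Unset Strict Implicit.
Unset Printing Implicit Defensive.
Import Order.TTheory GRing.Theory Num.Theory.
Import numFieldNormedType.Exports.
Local Open Scope classical_set_scope.
Local Open Scope ring_scope.

(** A filter on the subtype, pushed forward along [set_val], contains [A], so it clusters at a point
    of [A]. Open sets of the subtype are traces of open sets of [X], so that point is also a cluster
    point in the subtype. *)
Lemma set_type_compact (X : topologicalType) (A : set X) :
  compact A -> compact [set: set_type A].
Proof.
move=> cA F PF _.
have FA : (set_val @ F : set_system X) A.
  rewrite /fmap /=; apply: filterS (@filterT _ F _) => y _.
  exact: set_valP.
have [a [Aa clFa]] := cA _ (fmap_proper_filter _ PF) FA.
exists (exist _ a (mem_set Aa)); split=> // U V FU.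
case=> W [[G oG <-] Ga] GV.
have [_ [[y Uy <-] Gy]] : (set_val @` U) `&` G !=set0.
  apply: clFa; last exact: open_nbhs_nbhs.
  by apply: (filterS (F := F)) FU => y Uy; exists y.
by exists y; split => //; apply: GV.
Qed.

Section stone_cech_theory.
Variables (R : realType) (X : topologicalType).
Implicit Type i : unit_function R X.

Definition unit_cube : set (prod_topology (fun _ : unit_function R X => R)) :=
  [set u | forall i, `[0, 1]%classic (u i)].

(* [{classic I}] is [I] with the decidable equality that the library asks of the
   index set of a product. *)
Lemma unit_cube_compact : compact unit_cube.
Proof.
apply: (@tychonoff {classic (unit_function R X)} (fun=> R)
  (fun=> `[0, 1]%classic)) => _.
exact: segment_compact.
Qed.

Lemma hausdorff_unit_product :
  hausdorff_space (prod_topology (fun _ : unit_function R X => R)).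
Proof.
apply: (@hausdorff_product {classic (unit_function R X)} (fun=> R)) => _.
exact: Rhausdorff.
Qed.

Lemma closure_unit_evaluation_sub :
  closure (range (@unit_evaluation R X)) `<=` unit_cube.
Proof.
have cubeC : closed unit_cube.
  exact: compact_closed hausdorff_unit_product unit_cube_compact.
rewrite [Y in _ `<=` Y](iffLR (closure_id _) cubeC); apply: closure_subset.
by move=> _ [x _ <-] i; case: (svalP i) => _; apply; exists x.
Qed.

Lemma stone_cech_compact : compact [set: stone_cech R X].
Proof.
apply/set_type_compact/(subclosed_compact _ unit_cube_compact).
  exact: closed_closure.
exact: closure_unit_evaluation_sub.
Qed.

(** Makes singletons Borel, which the inner regularity of Dirac masses relies on. *)
Lemma stone_cech_closed1 (p : stone_cech R X) : closed [set p].
Proof.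
rewrite (_ : [set p] = set_val @^-1` [set set_val p]); last first.
  by apply/seteqP; split=> q /=; [move=> -> | exact: val_inj].
apply: (@closed_comp (stone_cech R X)) => [q _|]; first exact: initial_continuous.
exact: compact_closed hausdorff_unit_product (@compact_set1 _ _).
Qed.

(** The coordinate of index [i]. At the image of [x] it reduces to [sval i x], so it extends [i] to
    the compactification. *)
Definition stone_cech_extension i : stone_cech R X -> R := fun p => set_val p i.

Lemma stone_cech_extension_continuous i : continuous (stone_cech_extension i).
Proof.
move=> p.
apply: (@continuous_comp _ _ _ (set_val : stone_cech R X -> _) (fun u => u i)).
  exact: (@initial_continuous _ _ set_val).
exact: (@proj_continuous {classic (unit_function R X)} (fun=> R) i).
Qed.

Lemma stone_cech_extension_itv i p : 0 <= stone_cech_extension i p <= 1.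
Proof. by have := closure_unit_evaluation_sub (set_valP p) i; rewrite /= in_itv. Qed.

End stone_cech_theory.

Lemma continuous_borel_measurable (R : realType) (B : topologicalType)
    (B0 : inhabited B) (f : B -> R) :
  continuous f -> measurable_fun [set: borel_space B0] f.
Proof.
move=> /continuousP cf mT; apply: (measurability _ (RGenOInfty.measurableE R)) => //.
move=> _ [_ [a ->] <-]; rewrite setTI; apply: sub_sigma_algebra.
by apply: cf; exact: interval_open.
Qed.

(** The weak topology is a supremum of initial topologies, one of which is that of
    [radon_integral f]. *)
Lemma radon_integral_continuous (R : realType) (B : topologicalType)
    (f : B -> R) :
  continuous f -> continuous (@radon_integral R B f).
Proof.
move=> cf mu.
have /cvg_sup/(_ (exist _ f cf)) : nbhs mu --> mu by exact: cvg_id.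
move=> h; apply: cvg_trans (@initial_continuous _ _ (radon_integral f) mu).
exact: cvg_app h.
Qed.

Section borel_dirac.
Variables (R : realType) (B : topologicalType) (B0 : inhabited B) (b : B).

(* The value is 0 off the Borel sets because [radon_off_borel] demands it. *)
Definition borel_dirac (A : set (borel_space B0)) : \bar R :=
  if `[< <<s @open B >> A >] then \d_(b : borel_space B0) A else 0%E.

Lemma borel_diracE A : <<s @open B >> A -> borel_dirac A = \d_(b : borel_space B0) A.
Proof. by move=> mA; rewrite /borel_dirac asboolT. Qed.

Lemma borel_dirac_out A : ~ <<s @open B >> A -> borel_dirac A = 0%E.
Proof. by move=> mA; rewrite /borel_dirac asboolF. Qed.

Let borel_dirac0 : borel_dirac set0 = 0%E.
Proof. by rewrite borel_diracE ?measure0//; exact: sigma_algebra0. Qed.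

Let borel_dirac_ge0 A : (0 <= borel_dirac A)%E.
Proof. by rewrite /borel_dirac; case: ifP. Qed.

Let borel_dirac_sigma_additive : semi_sigma_additive borel_dirac.
Proof.
move=> F mF tF mUF; rewrite borel_diracE//.
have sumE : (fun n => \sum_(0 <= k < n) borel_dirac (F k))%E =
    (fun n => \sum_(0 <= k < n) \d_(b : borel_space B0) (F k))%E.
  by apply/funext => n; apply: eq_bigr => k _; apply: borel_diracE; exact: mF.
rewrite sumE; exact: measure_semi_sigma_additive mF tF mUF.
Qed.

HB.instance Definition _ := isMeasure.Build _ _ _ borel_dirac
  borel_dirac0 borel_dirac_ge0 borel_dirac_sigma_additive.

Let borel_diracT : borel_dirac setT = 1%E.
Proof. by rewrite borel_diracE ?diracT//; exact: (@measurableT _ (borel_space B0)). Qed.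

HB.instance Definition _ := Measure_isProbability.Build _ _ _ borel_dirac
  borel_diracT.

Hypothesis b_closed : closed [set b].

Lemma borel_dirac_inner_regular A : <<s @open B >> A ->
  borel_dirac A =
    ereal_sup [set borel_dirac K | K in [set K : set B | compact K /\ K `<=` A]].
Proof.
move=> mA; apply/eqP; rewrite eq_le; apply/andP; split.
  rewrite borel_diracE// diracE; have [bA|_] := boolP (b \in A); last first.
    apply: ereal_sup_ubound; exists set0; last exact: measure0.
    (* If [b] is not in [A], the value is 0 and the empty set attains it; otherwise [[set b]]
       attains the value 1. *)
    by split; [exact: compact0 | exact: sub0set].
  apply: ereal_sup_ubound; exists [set b].
    by split; [exact: compact_set1 | move=> _ ->; exact: set_mem].
  rewrite borel_diracE ?diracE ?mem_set//.
  rewrite -(setCK [set b]); apply: (@measurableC _ (borel_space B0)).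
  by apply: sub_sigma_algebra; exact: closed_openC.
apply: ge_ereal_sup => _ [K [_ KA] <-].
(* [B] is not assumed Hausdorff, so a compact [K] may fail to be Borel; its value is then 0. *)
have [mK|mK] := pselect (<<s @open B >> K); last by rewrite borel_dirac_out.
by apply: le_measure => //; rewrite inE.
Qed.

Definition radon_dirac : radon_probability R B :=
  @RadonProbability R B B0 borel_dirac borel_dirac_inner_regular borel_dirac_out.

Lemma radon_integral_dirac (f : B -> R) :
  continuous f -> radon_integral f radon_dirac = f b.
Proof.
move=> cf; rewrite /radon_integral /Rintegral /=.
(* The integral depends only on the values on Borel sets, where the two measures agree. *)
rewrite (eq_measure_integral (dirac (b : borel_space B0))); last first.
  by move=> A mA _; exact: borel_diracE.
rewrite integral_dirac//; last first.
  by apply/measurable_EFinP; exact: continuous_borel_measurable.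
by rewrite diracT mul1e.
Qed.

End borel_dirac.

Section radon_dirac_P_tau.
Variables (R : realType) (X : topologicalType) (x : X).

Definition radon_dirac_embedding : radon_probability R (stone_cech R X) :=
  radon_dirac R (inhabits (stone_cech_embedding R x))
    (@stone_cech_closed1 R X (stone_cech_embedding R x)).

Lemma radon_dirac_embedding_P_tau : radon_dirac_embedding \in
  [set mu : radon_probability R (stone_cech R X) |
    forall K : set (stone_cech R X),
      compact K -> K `&` range (@stone_cech_embedding R X) = set0 ->
      radon_measure mu K = 0%E].
Proof.
rewrite inE => K _ KX /=; rewrite /borel_dirac; case: ifP => // _.
rewrite diracE memNset// => Kx.
by have : set0 (stone_cech_embedding R x) by rewrite -KX; split=> //; exists x.
Qed.

Definition P_tau_dirac : P_tau R X :=
  exist (fun mu => mu \in _) radon_dirac_embedding radon_dirac_embedding_P_tau.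

End radon_dirac_P_tau.

Lemma P_tau_integral_gt0 (R : realType) (X : topologicalType)
    (i : unit_function R X) (mu : P_tau R X) :
  (forall x, 0 < sval i x) ->
  0 < radon_integral (stone_cech_extension i) (set_val mu).
Proof.
move=> i0; set h := stone_cech_extension i.
have h0 p : 0 <= h p by case/andP: (stone_cech_extension_itv i p).
have h1 p : h p <= 1 by case/andP: (stone_cech_extension_itv i p).
have ch : continuous h := @stone_cech_extension_continuous R X i.
have KC : closed [set p | h p = 0].
  apply: (@closed_comp _ _ h [set 0]) => [p _|]; first exact: ch.
  exact: closed_eq.
have muK : radon_measure (set_val mu) [set p | h p = 0] = 0%E.
  apply: (set_valP mu).
    exact: subclosed_compact KC (@stone_cech_compact R X) _.
  apply/seteqP; split=> // p [hp [x _ xp]].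
  have {}hp : sval i x = 0 by rewrite -xp in hp; exact: hp.
  by have := i0 x; rewrite hp ltxx.
case: (set_val mu) muK => B0 m m_reg m_out /= muK.
rewrite /radon_integral /Rintegral /=.
have mh : measurable_fun [set: borel_space B0] (EFin \o h).
  by apply/measurable_EFinP; exact: continuous_borel_measurable.
have mT := @measurableT _ (borel_space B0).
(* The real integral is the finite part of an extended one, so positivity also requires that the
   latter be finite. *)
rewrite fine_gt0//; apply/andP; split.
  rewrite lt_neqAle integral_ge0 ?andbT; last by move=> p _; rewrite lee_fin.
  (* A zero integral would make [h] vanish outside a null set [N]. Then [N] and the zero set of [h],
     both null, would cover a space of measure 1. *)
  apply/eqP => int0.
  have : (\int[m]_x `|(EFin \o h) x|)%E = 0%E.
    by rewrite int0; apply: eq_integral => p _; rewrite gee0_abs ?lee_fin.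
  move/(ae_eq_integral_abs m mT mh) => [N [mN N0 hN]].
  have mK : (@open (pointed_space B0)).-sigma.-measurable [set p | h p = 0].
    rewrite -(setCK [set p | _]); apply: measurableC.
    by apply: sub_sigma_algebra; exact: closed_openC.
  have : (m [set: borel_space B0] <= m (N `|` [set p | h p = 0%R]))%E.
    apply: le_measure; rewrite ?inE//; first exact: measurableU.
    move=> p _; have [|hp] := pselect (h p = 0); [by right|left].
    by apply: hN => /= /(_ I) [].
  apply/negP; rewrite -ltNge probability_setT.
  apply: le_lt_trans (measureU2 _ mN mK) _.
  rewrite (_ : (_ + _)%E = 0%E) ?lte_fin//.
  by rewrite -[RHS]adde0; exact: (f_equal2 adde N0 muK).
(* Finiteness: [h] is at most 1 and [m] has total mass 1. *)
apply: (@le_lt_trans _ _ (\int[m]_(x in setT) cst 1 x)%E).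
  apply: ge0_le_integral => //.
  - by move=> p _; rewrite lee_fin.
  - by move=> p _; rewrite lee_fin.
by rewrite integral_cst// mul1e [X in (X < _)%E](probability_setT m) ltry.
Qed.

Theorem proposition1p24 (R : realType) (X : topologicalType)
  (tX : tychonoff_space X) (pP : pseudocompact R (P_tau R X)) :
  pseudocompact R X.
Proof.
move=> f cf.
have f1 x : 0 < 1 + `|f x| by rewrite ltr_pwDl.
have i_unit : continuous (fun x => (1 + `|f x|)^-1) /\
    range (fun x => (1 + `|f x|)^-1) `<=` `[0, 1].
  split=> [x|_ [x _ <-]].
    apply: cvgV; first by rewrite gt_eqF.
    by apply: cvgD; [exact: cvg_cst | apply: cvg_norm; exact: cf].
  by rewrite /= in_itv /= invr_ge0 ltW//= invf_le1// lerDl.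
pose i : unit_function R X := exist _ _ i_unit.
pose J (mu : P_tau R X) := radon_integral (stone_cech_extension i) (set_val mu).
have J0 mu : 0 < J mu.
  by apply: P_tau_integral_gt0 => x; rewrite /= invr_gt0.
have cJ : continuous J.
  move=> mu; apply: (@continuous_comp _ _ _ (set_val : P_tau R X -> _)
    (radon_integral (stone_cech_extension i))).
    exact: (@initial_continuous _ _ set_val).
  exact/radon_integral_continuous/stone_cech_extension_continuous.
have : bounded_fun (fun mu => (J mu)^-1).
  apply: pP => mu; have J_neq0 : J mu != 0 by rewrite gt_eqF.
  exact: cvgV J_neq0 (cJ mu).
(* The bound for the inverse of [J] serves for [f] too, since [|f x|] is at most [1 + |f x|], the
   value of that inverse at the Dirac mass of [x]. *)
case=> M [Mreal JM]; exists M; split=> // r Mr x _.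
have Jx : J (P_tau_dirac R x) = (1 + `|f x|)^-1.
  exact/radon_integral_dirac/stone_cech_extension_continuous.
have := JM r Mr (P_tau_dirac R x) I.
by rewrite /= Jx invrK (gtr0_norm (f1 x)); apply: le_trans; rewrite lerDr.
Qed.
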